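(* (Cut elimination and subformula property for D.LL.) Every sequent derivable in D.LL is derivable in D.LL without any application of the Cut rules (neither the $\mathsf{L}$-type Cut nor the $\mathsf{P}$-type or $\mathsf{P}^{\mathrm{op}}$-type Cut). Moreover, D.LL has the subformula property: in every cut-free derivation in D.LL, every formula occurring in the derivation is a subformula of some formula occurring in the end-sequent.
   Context: **Language of D.LL** over a set $\mathsf{AtProp}$ of atomic propositions $p$. There are three types $\mathsf{L}$ (Lattice), $\mathsf{P}$ (Left), $\mathsf{P}^{\mathrm{op}}$ (Right), each with formulas and structures. - Type $\mathsf{L}$: formulas $A::=p\mid\top\mid\bot\mid ◆\alpha\mid\blacksquare\xi$; structures $X::=A\mid \mathrm{I}\mid\bullet\Gamma\mid\bullet\Pi$. - Type $\mathsf{P}$: formulas $\alpha::=\Box A\mid\alpha\cap\alpha\mid\alpha\cup\alpha$; structures $\Gamma::=\alpha\mid\circ X\mid\circledS\mid\Gamma\cdot\Gamma\mid\Gamma\supset\Gamma$. - Type $\mathsf{P}^{\mathrm{op}}$: formulas $\xi::=\Diamond A\mid\xi\cap\xi\mid\xi\cup\xi$; structures $\Pi::=\xi\mid\circ X\mid\circledS\mid\Pi\cdot\Pi\mid\Pi\supset\Pi$. (The connectives $\cap,\cup,\circledS,\cdot,\supset$ of type $\mathsf{P}^{\mathrm{op}}$ carry a superscript $^{\mathrm{op}}$ which is suppressed.) A sequent $x\vdash y$ has $x,y$ structures of the same type. In $x\vdash y$, $x$ is in precedent position and $y$ in succedent position; substructures inherit the position of the parent, except that the first argument of $\supset$ has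 the opposite position. Only sequents are considered in which $\circ X$ of type $\mathsf{P}$ and $\bullet\Pi$ occur only in succedent position, and $\circ X$ of type $\mathsf{P}^{\mathrm{op}}$ and $\bullet\Gamma$ occur only in precedent position. **Rules of D.LL.** Notation: ''premises / conclusion''; ''//'' denotes a double-line rule, usable in both directions. $X,Y$ are $\mathsf{L}$-structures, $\Gamma$ a $\mathsf{P}$-structure, $\Pi$ a $\mathsf{P}^{\mathrm{op}}$-structure. In the pure-type rules $S,T,U,V$ are structures and $s,t$ formulas, all of the same type, which is either $\mathsf{P}$ or $\mathsf{P}^{\mathrm{op}}$. - Multi-type display rules: $\Gamma\vdash\circ X$ // $\bullet\Gamma\vdash X$; $\ \circ X\vdash\Pi$ // $X\vdash\bullet\Pi$. - Pure $\mathsf{P}$/$\mathsf{P}^{\mathrm{op}}$ display rules: $S\cdot T\vdash U$ // $T\vdash S\supset U$; $\ S\vdash T\cdot U$ // $T\supset S\vdash U$. - Pure $\mathsf{P}$/$\mathsf{P}^{\mathrm{op}}$ structural rules. Cut: $S\vdash s$, $s\vdash T$ / $S\vdash T$. Unit: $S\vdash T$ // $S\cdot\circledS\vdash T$; $S\vdash T$ // $S\vdash T\cdot\circledS$. Exchange: $S\cdot T\vdash U$ / $T\cdot S\vdash U$; $S\vdash T\cdot U$ / $S\vdash U\cdot T$. Associativity: $(S\cdot T)\cdot U\vdash V$ // $S\cdot(T\cdot U)\vdash V$; $S\vdash(T\cdot U)\cdot V$ // $S\vdash T\cdot(U\cdot V)$. Weakening: $S\vdash T$ / $S\cdot U\vdash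 T$; $S\vdash T$ / $S\vdash T\cdot U$. Contraction: $S\cdot S\vdash T$ / $S\vdash T$; $S\vdash T\cdot T$ / $S\vdash T$. - Pure $\mathsf{P}$/$\mathsf{P}^{\mathrm{op}}$ operational rules: $s\cdot t\vdash S$ / $s\cap t\vdash S$; $\ S\vdash s$, $T\vdash t$ / $S\cdot T\vdash s\cap t$; $\ s\vdash S$, $t\vdash T$ / $s\cup t\vdash S\cdot T$; $\ S\vdash s\cdot t$ / $S\vdash s\cup t$. - Pure $\mathsf{L}$ rules. Id: $p\vdash p$ (axiom, $p$ atomic). Cut: $X\vdash A$, $A\vdash Y$ / $X\vdash Y$. $\mathrm{I}$-weakening: $\mathrm{I}\vdash X$ / $Y\vdash X$; $X\vdash\mathrm{I}$ / $X\vdash Y$. Constants: $\mathrm{I}\vdash X$ / $\top\vdash X$; $\mathrm{I}\vdash\top$ (axiom); $\bot\vdash\mathrm{I}$ (axiom); $X\vdash\mathrm{I}$ / $X\vdash\bot$. - Operational rules for multi-type connectives: $\circ A\vdash\Pi$ / $\Diamond A\vdash\Pi$; $\ X\vdash A$ / $\circ X\vdash\Diamond A$ (type $\mathsf{P}^{\mathrm{op}}$); $\ X\vdash\bullet\xi$ / $X\vdash\blacksquare\xi$; $\ \xi\vdash\Pi$ / $\blacksquare\xi\vdash\bullet\Pi$; $\ \bullet\alpha\vdash X$ / $◆\alpha\vdash X$; $\ \Gamma\vdash\alpha$ / $\bullet\Gamma\vdash ◆\alpha$; $\ \Gamma\vdash\circ A$ / $\Gamma\vdash\Box A$; $\ A\vdash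 X$ / $\Box A\vdash\circ X$ (type $\mathsf{P}$). *)

(* Defs.v *)
Set Implicit Arguments.
Unset Strict Implicit.
Unset Printing Implicit Defensive.

(* [Pure Left] is the type P and [Pure Right] is the type P^op, so that a rule
   common to both is stated once, for an arbitrary [k : side]. *)
Inductive side : Set := Left | Right.
Inductive ty : Set := Lattice | Pure (k : side).

Inductive formula (AtProp : Type) : ty -> Type :=
| Atom (p : AtProp) : formula AtProp Lattice
| Top : formula AtProp Lattice
| Bot : formula AtProp Lattice
| BlackDiamond (a : formula AtProp (Pure Left)) : formula AtProp Lattice
| BlackBox (x : formula AtProp (Pure Right)) : formula AtProp Lattice
| Box (A : formula AtProp Lattice) : formula AtProp (Pure Left)
| Diamond (A : formula AtProp Lattice) : formula AtProp (Pure Right)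
| Cap (k : side) (s t : formula AtProp (Pure k)) : formula AtProp (Pure k)
| Cup (k : side) (s t : formula AtProp (Pure k)) : formula AtProp (Pure k).

Arguments Atom {AtProp} p.
Arguments Top {AtProp}.
Arguments Bot {AtProp}.

Inductive structure (AtProp : Type) : ty -> Type :=
| Fm (t : ty) (A : formula AtProp t) : structure AtProp t
| SI : structure AtProp Lattice
| Bullet (k : side) (S : structure AtProp (Pure k)) : structure AtProp Lattice
| Circ (k : side) (X : structure AtProp Lattice) : structure AtProp (Pure k)
| Unit (k : side) : structure AtProp (Pure k)
| Dot (k : side) (S T : structure AtProp (Pure k)) : structure AtProp (Pure k)
| Sup (k : side) (S T : structure AtProp (Pure k)) : structure AtProp (Pure k).

Arguments SI {AtProp}.
Arguments Circ {AtProp} k X.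
Arguments Unit {AtProp} k.

Record sequent (AtProp : Type) : Type := Sequent {
  seq_type : ty;
  precedent : structure AtProp seq_type;
  succedent : structure AtProp seq_type
}.

Declare Scope dll_scope.
Delimit Scope dll_scope with dll.
Notation "x ⊢ y" := (Sequent x y) (at level 70, no associativity) : dll_scope.
Notation "S · T" := (Dot S T) (at level 50, left associativity) : dll_scope.
Notation "S ⊃ T" := (Sup S T) (at level 55, right associativity) : dll_scope.
Local Open Scope dll_scope.

Inductive position : Set := Precedent | Succedent.

Definition opposite (q : position) : position :=
  match q with Precedent => Succedent | Succedent => Precedent end.

(* [•S] may stand in precedent position when [S] has type P and in succedent
   position when [S] has type P^op; for [∘X] it is the other way round. *)
Definition bullet_position (k : side) : position :=
  match k with Left => Precedent | Right => Succedent end.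
Definition circ_position (k : side) : position :=
  match k with Left => Succedent | Right => Precedent end.

Fixpoint admissible (AtProp : Type) (q : position) (t : ty)
    (x : structure AtProp t) : Prop :=
  match x with
  | Fm _ => True
  | SI => True
  | @Bullet _ k T => q = bullet_position k /\ admissible q T
  | Circ k X => q = circ_position k /\ admissible q X
  | Unit _ => True
  | Dot T U => admissible q T /\ admissible q U
  | Sup T U => admissible (opposite q) T /\ admissible q U
  end.

Definition admissible_sequent (AtProp : Type) (c : sequent AtProp) : Prop :=
  admissible Precedent (precedent c) /\ admissible Succedent (succedent c).

(* In all the rule relations below, the last argument is the conclusion. *)

Inductive axiom (AtProp : Type) : sequent AtProp -> Prop :=
| Id p : axiom (Fm (Atom p) ⊢ Fm (Atom p))
| Top_right : axiom (SI ⊢ Fm Top)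
| Bot_left : axiom (Fm Bot ⊢ SI).

(* Upper sequent first, lower sequent second. *)
Inductive double_line_rule (AtProp : Type) :
    sequent AtProp -> sequent AtProp -> Prop :=
| Display_circ_bullet_left (S : structure AtProp (Pure Left)) X :
    double_line_rule (S ⊢ Circ Left X) (Bullet S ⊢ X)
| Display_circ_bullet_right X (S : structure AtProp (Pure Right)) :
    double_line_rule (Circ Right X ⊢ S) (X ⊢ Bullet S)
| Display_left k (S T U : structure AtProp (Pure k)) :
    double_line_rule (S · T ⊢ U) (T ⊢ S ⊃ U)
| Display_right k (S T U : structure AtProp (Pure k)) :
    double_line_rule (S ⊢ T · U) (T ⊃ S ⊢ U)
| Unit_left k (S T : structure AtProp (Pure k)) :
    double_line_rule (S ⊢ T) (S · Unit k ⊢ T)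
| Unit_right k (S T : structure AtProp (Pure k)) :
    double_line_rule (S ⊢ T) (S ⊢ T · Unit k)
| Associativity_left k (S T U V : structure AtProp (Pure k)) :
    double_line_rule ((S · T) · U ⊢ V) (S · (T · U) ⊢ V)
| Associativity_right k (S T U V : structure AtProp (Pure k)) :
    double_line_rule (S ⊢ (T · U) · V) (S ⊢ T · (U · V)).

Inductive unary_rule (AtProp : Type) :
    sequent AtProp -> sequent AtProp -> Prop :=
| Downwards c d : double_line_rule c d -> unary_rule c d
| Upwards c d : double_line_rule c d -> unary_rule d c
| Exchange_left k (S T U : structure AtProp (Pure k)) :
    unary_rule (S · T ⊢ U) (T · S ⊢ U)
| Exchange_right k (S T U : structure AtProp (Pure k)) :
    unary_rule (S ⊢ T · U) (S ⊢ U · T)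
| Weakening_left k (S T U : structure AtProp (Pure k)) :
    unary_rule (S ⊢ T) (S · U ⊢ T)
| Weakening_right k (S T U : structure AtProp (Pure k)) :
    unary_rule (S ⊢ T) (S ⊢ T · U)
| Contraction_left k (S T : structure AtProp (Pure k)) :
    unary_rule (S · S ⊢ T) (S ⊢ T)
| Contraction_right k (S T : structure AtProp (Pure k)) :
    unary_rule (S ⊢ T · T) (S ⊢ T)
| Cap_left k (s t : formula AtProp (Pure k)) S :
    unary_rule (Fm s · Fm t ⊢ S) (Fm (Cap s t) ⊢ S)
| Cup_right k S (s t : formula AtProp (Pure k)) :
    unary_rule (S ⊢ Fm s · Fm t) (S ⊢ Fm (Cup s t))
| I_weakening_left (X Y : structure AtProp Lattice) :
    unary_rule (SI ⊢ X) (Y ⊢ X)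
| I_weakening_right (X Y : structure AtProp Lattice) :
    unary_rule (X ⊢ SI) (X ⊢ Y)
| Top_left (X : structure AtProp Lattice) :
    unary_rule (SI ⊢ X) (Fm Top ⊢ X)
| Bot_right (X : structure AtProp Lattice) :
    unary_rule (X ⊢ SI) (X ⊢ Fm Bot)
| Diamond_left (A : formula AtProp Lattice) S :
    unary_rule (Circ Right (Fm A) ⊢ S) (Fm (Diamond A) ⊢ S)
| Diamond_right X (A : formula AtProp Lattice) :
    unary_rule (X ⊢ Fm A) (Circ Right X ⊢ Fm (Diamond A))
| BlackBox_right X (x : formula AtProp (Pure Right)) :
    unary_rule (X ⊢ Bullet (Fm x)) (X ⊢ Fm (BlackBox x))
| BlackBox_left (x : formula AtProp (Pure Right)) S :
    unary_rule (Fm x ⊢ S) (Fm (BlackBox x) ⊢ Bullet S)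
| BlackDiamond_left (a : formula AtProp (Pure Left)) X :
    unary_rule (Bullet (Fm a) ⊢ X) (Fm (BlackDiamond a) ⊢ X)
| BlackDiamond_right S (a : formula AtProp (Pure Left)) :
    unary_rule (S ⊢ Fm a) (Bullet S ⊢ Fm (BlackDiamond a))
| Box_right S (A : formula AtProp Lattice) :
    unary_rule (S ⊢ Circ Left (Fm A)) (S ⊢ Fm (Box A))
| Box_left (A : formula AtProp Lattice) X :
    unary_rule (Fm A ⊢ X) (Fm (Box A) ⊢ Circ Left X).

Inductive binary_rule (AtProp : Type) :
    sequent AtProp -> sequent AtProp -> sequent AtProp -> Prop :=
| Cap_right k S T (s t : formula AtProp (Pure k)) :
    binary_rule (S ⊢ Fm s) (T ⊢ Fm t) (S · T ⊢ Fm (Cap s t))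
| Cup_left k (s t : formula AtProp (Pure k)) S T :
    binary_rule (Fm s ⊢ S) (Fm t ⊢ T) (Fm (Cup s t) ⊢ S · T).

(* One Cut for each type [t]. *)
Inductive cut_rule (AtProp : Type) :
    sequent AtProp -> sequent AtProp -> sequent AtProp -> Prop :=
| Cut (t : ty) (x : structure AtProp t) (A : formula AtProp t) y :
    cut_rule (x ⊢ Fm A) (Fm A ⊢ y) (x ⊢ y).

(* Since only admissible sequents are considered, every node of a derivation
   is required to be labelled with one. *)
Inductive derivation (AtProp : Type) : sequent AtProp -> Type :=
| By_axiom c : admissible_sequent c -> axiom c -> derivation c
| By_unary c1 c : admissible_sequent c -> unary_rule c1 c ->
    derivation c1 -> derivation c
| By_binary c1 c2 c : admissible_sequent c -> binary_rule c1 c2 c ->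
    derivation c1 -> derivation c2 -> derivation c
| By_cut c1 c2 c : admissible_sequent c -> cut_rule c1 c2 c ->
    derivation c1 -> derivation c2 -> derivation c.

Fixpoint cut_free (AtProp : Type) (c : sequent AtProp) (d : derivation c) :
    Prop :=
  match d with
  | By_axiom _ _ => True
  | By_unary _ _ d1 => cut_free d1
  | By_binary _ _ d1 d2 => cut_free d1 /\ cut_free d2
  | By_cut _ _ _ _ => False
  end.

Definition derivable (AtProp : Type) (c : sequent AtProp) : Prop :=
  inhabited (derivation c).

Definition cut_free_derivable (AtProp : Type) (c : sequent AtProp) : Prop :=
  exists d : derivation c, cut_free d.

(* The two formulas need not have the same type. *)
Inductive subformula (AtProp : Type) (t : ty) (A : formula AtProp t) :
    forall u : ty, formula AtProp u -> Prop :=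
| Sub_refl : subformula A A
| Sub_BlackDiamond a : subformula A a -> subformula A (BlackDiamond a)
| Sub_BlackBox x : subformula A x -> subformula A (BlackBox x)
| Sub_Box B : subformula A B -> subformula A (Box B)
| Sub_Diamond B : subformula A B -> subformula A (Diamond B)
| Sub_Cap_l k (r s : formula AtProp (Pure k)) :
    subformula A r -> subformula A (Cap r s)
| Sub_Cap_r k (r s : formula AtProp (Pure k)) :
    subformula A s -> subformula A (Cap r s)
| Sub_Cup_l k (r s : formula AtProp (Pure k)) :
    subformula A r -> subformula A (Cup r s)
| Sub_Cup_r k (r s : formula AtProp (Pure k)) :
    subformula A s -> subformula A (Cup r s).

(* Formulas occur in a structure as its leaves; formulas nested inside these
   leaves are subformulas, not further occurrences. *)
Inductive occurs_in (AtProp : Type) (t : ty) (A : formula AtProp t) :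
    forall u : ty, structure AtProp u -> Prop :=
| Occ_Fm : occurs_in A (Fm A)
| Occ_Bullet k (S : structure AtProp (Pure k)) :
    occurs_in A S -> occurs_in A (Bullet S)
| Occ_Circ k X : occurs_in A X -> occurs_in A (Circ k X)
| Occ_Dot_l k (S T : structure AtProp (Pure k)) :
    occurs_in A S -> occurs_in A (S · T)
| Occ_Dot_r k (S T : structure AtProp (Pure k)) :
    occurs_in A T -> occurs_in A (S · T)
| Occ_Sup_l k (S T : structure AtProp (Pure k)) :
    occurs_in A S -> occurs_in A (S ⊃ T)
| Occ_Sup_r k (S T : structure AtProp (Pure k)) :
    occurs_in A T -> occurs_in A (S ⊃ T).

Definition occurs_in_sequent (AtProp : Type) (t : ty) (A : formula AtProp t)
    (c : sequent AtProp) : Prop :=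
  occurs_in A (precedent c) \/ occurs_in A (succedent c).

Fixpoint occurs_in_derivation (AtProp : Type) (t : ty) (A : formula AtProp t)
    (c : sequent AtProp) (d : derivation c) : Prop :=
  occurs_in_sequent A c \/
  match d with
  | By_axiom _ _ => False
  | By_unary _ _ d1 => occurs_in_derivation A d1
  | By_binary _ _ d1 d2 => occurs_in_derivation A d1 \/ occurs_in_derivation A d2
  | By_cut _ _ d1 d2 => occurs_in_derivation A d1 \/ occurs_in_derivation A d2
  end.

(* Main.v *)
Require Import Defs.
From Stdlib Require Import Setoid.

(** Cut elimination is proved semantically, without rewriting derivations.
    Every formula [A] is interpreted by a set of precedents [member Precedent A]
    and a set of succedents [member Succedent A], each being the set of all
    structures that stand in the relation [provable] (cut-free provability) to
    every element of the other.  A sequent is [valid] when replacing,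
    independently, each of its precedent leaves [A] by an element of
    [member Precedent A] and each of its succedent leaves by an element of
    [member Succedent A] always yields a cut-free provable sequent.

    Structural and display rules do not look inside leaves, so they commute with
    such replacements and preserve validity.  Cut preserves validity because the
    two sets attached to the cut formula are polar to each other
    ([member_precedent]): this takes the place of the usual induction on cut
    formulas.  A logical rule preserves validity because the sets attached to its
    principal formula are generated from those attached to the immediate
    subformulas according to the meaning of the connective.  Hence every derivable
    sequent is valid ([derivation_valid]).  Finally [A] itself belongs to both of
    its sets ([formula_member]), so that a sequent is one of its own instances,
    and validity implies cut-free provability.

    The subformula property holds because, Cut aside, every formula in a premise
    is a subformula of a formula in the conclusion.  It is proved by showing that
    a predicate closed under subformulas passes from the leaves of the conclusion
    to those of the premises ([leaves_unary], [leaves_binary]). *)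

Set Implicit Arguments.
Unset Strict Implicit.
Unset Printing Implicit Defensive.

Local Open Scope dll_scope.

(** * Cut-free provability *)

Section CutElimination.

Variable AtProp : Type.

(** Admissibility is a hypothesis here, not a conjunct: the interpretation of
    formulas can then range over all structures, and admissibility is
    used only when a rule is applied. *)
Definition provable (c : sequent AtProp) : Prop :=
  admissible_sequent c -> cut_free_derivable c.

Lemma admissible_unary (c1 c : sequent AtProp) :
  unary_rule c1 c -> admissible_sequent c -> admissible_sequent c1.
Proof.
  intros r; destruct r as [? ? r | ? ? r | | | | | | | | | | | | | | | | | | | |];
    try destruct r; unfold admissible_sequent; cbn; intuition congruence.
Qed.

Lemma provable_unary (c1 c : sequent AtProp) :
  unary_rule c1 c -> provable c1 -> provable c.
Proof.
  intros r H adm; destruct (H (admissible_unary r adm)) as [d cf].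
  exists (By_unary adm r d); exact cf.
Qed.

Lemma provable_binary (c1 c2 c : sequent AtProp) :
  binary_rule c1 c2 c -> provable c1 -> provable c2 -> provable c.
Proof.
  intros r H1 H2 adm.
  assert (adm12 : admissible_sequent c1 /\ admissible_sequent c2).
  { destruct r; revert adm; unfold admissible_sequent; cbn; tauto. }
  destruct (H1 (proj1 adm12)) as [d1 cf1], (H2 (proj2 adm12)) as [d2 cf2].
  exists (By_binary adm r d1 d2); split; assumption.
Qed.

Lemma provable_axiom (c : sequent AtProp) : axiom c -> provable c.
Proof. intros a adm; exists (By_axiom adm a); exact I. Qed.

(** * The interpretation of formulas *)

Definition below (t : ty) (G : structure AtProp t -> Prop)
    (x : structure AtProp t) : Prop := forall y, G y -> provable (x ⊢ y).

Definition above (t : ty) (G : structure AtProp t -> Prop)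
    (y : structure AtProp t) : Prop := forall x, G x -> provable (x ⊢ y).

Definition succedent_generated (t : ty) (G : structure AtProp t -> Prop)
    (q : position) : structure AtProp t -> Prop :=
  match q with Precedent => below G | Succedent => above (below G) end.

Definition precedent_generated (t : ty) (G : structure AtProp t -> Prop)
    (q : position) : structure AtProp t -> Prop :=
  match q with Precedent => below (above G) | Succedent => above G end.

(** The connectives that commute with meets ([Top], [Cap], [Box], [BlackBox])
    are read off from what they prove, so their sets are generated by succedents;
    those that commute with joins are generated by precedents.  Modalities
    apply the matching structural connective to the members of the argument.
    For an atom either choice would do. *)
Fixpoint member (q : position) (t : ty) (A : formula AtProp t) {struct A} :
    structure AtProp t -> Prop :=
  match A in formula _ t return structure AtProp t -> Prop with
  | Atom p => succedent_generated (fun y => y = Fm (Atom p)) q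
  | Top => succedent_generated (fun _ => False) q
  | Bot => precedent_generated (fun _ => False) q
  | BlackDiamond a =>
      precedent_generated (fun x => exists U, member Precedent a U /\ x = Bullet U) q
  | BlackBox a =>
      succedent_generated (fun y => exists U, member Succedent a U /\ y = Bullet U) q
  | Box B =>
      succedent_generated (fun y => exists X, member Succedent B X /\ y = Circ Left X) q
  | Diamond B =>
      precedent_generated (fun x => exists X, member Precedent B X /\ x = Circ Right X) q
  | Cap r s =>
      succedent_generated (fun y => member Succedent r y \/ member Succedent s y) q
  | Cup r s =>
      precedent_generated (fun x => member Precedent r x \/ member Precedent s x) q
  end.

(** The triple polar of a set is its polar. *)
Lemma member_precedent (t : ty) (A : formula AtProp t) x :
  member Precedent A x <-> below (member Succedent A) x.
Proof.
  destruct A; cbn; unfold below, above; split; intros H y; auto.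
Qed.

Lemma member_succedent (t : ty) (A : formula AtProp t) y :
  member Succedent A y <-> above (member Precedent A) y.
Proof.
  destruct A; cbn; unfold below, above; split; intros H x; auto.
Qed.

Lemma member_provable (t : ty) (A : formula AtProp t) x y :
  member Precedent A x -> member Succedent A y -> provable (x ⊢ y).
Proof. intros Hx Hy; exact (proj1 (member_precedent A x) Hx y Hy). Qed.

Lemma member_cap (k : side) (r s : formula AtProp (Pure k)) x :
  member Precedent (Cap r s) x <-> member Precedent r x /\ member Precedent s x.
Proof.
  rewrite (member_precedent r), (member_precedent s); cbn; unfold below.
  firstorder.
Qed.

Lemma member_cup (k : side) (r s : formula AtProp (Pure k)) y :
  member Succedent (Cup r s) y <-> member Succedent r y /\ member Succedent s y.
Proof.
  rewrite (member_succedent r), (member_succedent s); cbn; unfold above.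
  firstorder.
Qed.

Lemma precedent_contraction (k : side) (x y : structure AtProp (Pure k)) :
  provable (x · x ⊢ y) -> provable (x ⊢ y).
Proof. apply provable_unary, Contraction_left. Qed.

Lemma succedent_contraction (k : side) (x y : structure AtProp (Pure k)) :
  provable (x ⊢ y · y) -> provable (x ⊢ y).
Proof. apply provable_unary, Contraction_right. Qed.

(** Weakening places a precedent [·] below the meet of its arguments; together
    with contraction it makes the two interchangeable. *)
Lemma member_dot_cap (k : side) (r s : formula AtProp (Pure k)) x1 x2 :
  member Precedent r x1 -> member Precedent s x2 ->
  member Precedent (Cap r s) (x1 · x2).
Proof.
  rewrite member_cap, !member_precedent; intros H1 H2; split; intros y Hy.
  - exact (provable_unary (Weakening_left _ _ _) (H1 y Hy)).
  - apply (provable_unary (Exchange_left _ _ _)).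
    exact (provable_unary (Weakening_left _ _ _) (H2 y Hy)).
Qed.

Lemma member_dot_cup (k : side) (r s : formula AtProp (Pure k)) y1 y2 :
  member Succedent r y1 -> member Succedent s y2 ->
  member Succedent (Cup r s) (y1 · y2).
Proof.
  rewrite member_cup, !member_succedent; intros H1 H2; split; intros x Hx.
  - exact (provable_unary (Weakening_right _ _ _) (H1 x Hx)).
  - apply (provable_unary (Exchange_right _ _ _)).
    exact (provable_unary (Weakening_right _ _ _) (H2 x Hx)).
Qed.

(** For each connective, one of its rules puts the compound formula in the polar
    of the generators and the other puts it in the second polar, because the
    immediate subformulas already belong to both of their own sets. *)
Lemma formula_member (t : ty) (A : formula AtProp t) :
  member Precedent A (Fm A) /\ member Succedent A (Fm A).
Proof.
  induction A as [p | | | a [IHp IHs] | a [IHp IHs] | B [IHp IHs] | B [IHp IHs]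
                 | k r [IHrp IHrs] s [IHsp IHss] | k r [IHrp IHrs] s [IHsp IHss]].
  - split.
    + intros y ->; apply provable_axiom, Id.
    + intros x Hx; exact (Hx _ eq_refl).
  - split.
    + intros y [].
    + intros x _; apply (provable_unary (I_weakening_left _ _)).
      apply provable_axiom, Top_right.
  - split.
    + intros y _; apply (provable_unary (I_weakening_right _ _)).
      apply provable_axiom, Bot_left.
    + intros x [].
  - split.
    + intros y Hy; apply (provable_unary (BlackDiamond_left _ _)), Hy; eauto.
    + intros x [T [HT ->]]; apply (provable_unary (BlackDiamond_right _ _)).
      exact (member_provable HT IHs).
  - split.
    + intros y [T [HT ->]]; apply (provable_unary (BlackBox_left _ _)).
      exact (member_provable IHp HT).
    + intros x Hx; apply (provable_unary (BlackBox_right _ _)), Hx; eauto.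
  - split.
    + intros y [X [HX ->]]; apply (provable_unary (Box_left _ _)).
      exact (member_provable IHp HX).
    + intros x Hx; apply (provable_unary (Box_right _ _)), Hx; eauto.
  - split.
    + intros y Hy; apply (provable_unary (Diamond_left _ _)), Hy; eauto.
    + intros x [X [HX ->]]; apply (provable_unary (Diamond_right _ _)).
      exact (member_provable HX IHs).
  - split.
    + intros y Hy; apply (provable_unary (Cap_left _ _ _)).
      (* [r · s] lies in the meet, whose members all prove [y]. *)
      exact (member_dot_cap IHrp IHsp Hy).
    + intros x Hx; apply member_cap in Hx as [Hr Hs].
      apply precedent_contraction, (provable_binary (Cap_right _ _ _ _)).
      * exact (member_provable Hr IHrs).
      * exact (member_provable Hs IHss).
  - split.
    + intros y Hy; apply member_cup in Hy as [Hr Hs].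
      apply succedent_contraction, (provable_binary (Cup_left _ _ _ _)).
      * exact (member_provable IHrp Hr).
      * exact (member_provable IHsp Hs).
    + intros x Hx; apply (provable_unary (Cup_right _ _ _)).
      exact (member_dot_cup IHrs IHss Hx).
Qed.

(** * Validity *)

Fixpoint instance (q : position) (t : ty) (x : structure AtProp t) {struct x} :
    structure AtProp t -> Prop :=
  match x in structure _ t return structure AtProp t -> Prop with
  | Fm A => member q A
  | SI => fun z => z = SI
  | Bullet U => fun z => exists U', instance q U U' /\ z = Bullet U'
  | Circ k X => fun z => exists X', instance q X X' /\ z = Circ k X'
  | Unit k => fun z => z = Unit k
  | Dot U V => fun z => exists U' V',
      instance q U U' /\ instance q V V' /\ z = U' · V'
  | Sup U V => fun z => exists U' V',
      instance (opposite q) U U' /\ instance q V V' /\ z = U' ⊃ V'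
  end.

Definition valid (c : sequent AtProp) : Prop :=
  forall x y, instance Precedent (precedent c) x ->
    instance Succedent (succedent c) y -> provable (x ⊢ y).

Lemma instance_refl (q : position) (t : ty) (x : structure AtProp t) :
  instance q x x.
Proof.
  revert q; induction x; intros q; cbn; eauto 7.
  destruct q; apply formula_member.
Qed.

Lemma valid_provable (c : sequent AtProp) : valid c -> provable c.
Proof. destruct c; intros H; apply H; apply instance_refl. Qed.

(** A rule that treats its leaves as parameters acts on instances of its
    premise exactly as it acts on the premise. *)
Ltac parametric :=
  intros H x y Hx Hy; cbn in x, y, Hx, Hy;
  repeat match goal with
  | h : exists _, _ |- _ => destruct h
  | h : _ /\ _ |- _ => destruct h
  end; subst;
  (* The instances at hand determine the premise, and then the rule. *)
  eapply provable_unary; [| apply H; cbn; eauto 10];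
  solve [constructor | apply Downwards; constructor | apply Upwards; constructor].

Lemma valid_double_line (c d : sequent AtProp) :
  double_line_rule c d -> (valid c -> valid d) /\ (valid d -> valid c).
Proof. intros r; destruct r; split; parametric. Qed.

Lemma valid_unary (c1 c : sequent AtProp) :
  unary_rule c1 c -> valid c1 -> valid c.
Proof.
  intros r; destruct r as [c d r | c d r | | | | | | | k s t U | k U s t | |
    | X | X | A U | X A | X a | a U | a X | U a | U A | A X].
  - exact (proj1 (valid_double_line r)).
  - exact (proj2 (valid_double_line r)).
  - parametric.
  - parametric.
  - parametric.
  - parametric.
  - parametric.
  - parametric.
  - intros H x y Hx Hy; apply member_cap in Hx as [Hs Ht].
    apply precedent_contraction, H; cbn; eauto 10.
  - intros H x y Hx Hy; apply member_cup in Hy as [Hs Ht].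
    apply succedent_contraction, H; cbn; eauto 10.
  - intros H x y _ Hy; apply (provable_unary (I_weakening_left _ _)).
    apply H; [reflexivity | exact Hy].
  - intros H x y Hx _; apply (provable_unary (I_weakening_right _ _)).
    apply H; [exact Hx | reflexivity].
  - intros H x y _ Hy; apply (provable_unary (I_weakening_left _ _)).
    apply H; [reflexivity | exact Hy].
  - intros H x y Hx _; apply (provable_unary (I_weakening_right _ _)).
    apply H; [exact Hx | reflexivity].
  (* In each remaining case, either the premise says that the parameter is in
     the polar of the generators of the principal formula, or the conclusion
     exhibits one of these generators. *)
  - intros H x y Hx Hy; apply Hx; intros z [X [HX ->]].
    apply H; cbn; eauto.
  - intros H x y [X' [HX ->]] Hy; apply Hy; exists X'; split; [| reflexivity].
    apply member_precedent; intros z Hz; exact (H _ _ HX Hz).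
  - intros H x y Hx Hy; apply Hy; intros z [T [HT ->]].
    apply H; cbn; eauto.
  - intros H x y Hx [S' [HS ->]]; apply Hx; exists S'; split; [| reflexivity].
    apply member_succedent; intros z Hz; exact (H _ _ Hz HS).
  - intros H x y Hx Hy; apply Hx; intros z [T [HT ->]].
    apply H; cbn; eauto.
  - intros H x y [S' [HS ->]] Hy; apply Hy; exists S'; split; [| reflexivity].
    apply member_precedent; intros z Hz; exact (H _ _ HS Hz).
  - intros H x y Hx Hy; apply Hy; intros z [X [HX ->]].
    apply H; cbn; eauto.
  - intros H x y Hx [X' [HX ->]]; apply Hx; exists X'; split; [| reflexivity].
    apply member_succedent; intros z Hz; exact (H _ _ Hz HX).
Qed.

Lemma valid_binary (c1 c2 c : sequent AtProp) :
  binary_rule c1 c2 c -> valid c1 -> valid c2 -> valid c.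
Proof.
  intros r; destruct r as [k U V s t | k s t U V].
  - intros H1 H2 x y [S' [T' [HS [HT ->]]]] Hy.
    refine (member_provable _ Hy); apply member_dot_cap; apply member_precedent.
    + intros z Hz; exact (H1 _ _ HS Hz).
    + intros z Hz; exact (H2 _ _ HT Hz).
  - intros H1 H2 x y Hx [S' [T' [HS [HT ->]]]].
    refine (member_provable Hx _); apply member_dot_cup; apply member_succedent.
    + intros z Hz; exact (H1 _ _ Hz HS).
    + intros z Hz; exact (H2 _ _ Hz HT).
Qed.

(** An instance [x] of the left-hand side proves every succedent of the cut
    formula, hence is one of its precedents, and may be substituted for the cut
    formula in the second premise. *)
Lemma valid_cut (c1 c2 c : sequent AtProp) :
  cut_rule c1 c2 c -> valid c1 -> valid c2 -> valid c.
Proof.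
  intros r; destruct r as [t x A y]; intros H1 H2 x' y' Hx Hy.
  apply H2; [| exact Hy].
  apply member_precedent; intros z Hz; exact (H1 _ _ Hx Hz).
Qed.

Lemma valid_axiom (c : sequent AtProp) : axiom c -> valid c.
Proof.
  intros a; destruct a as [p | |]; intros x y Hx Hy.
  - exact (member_provable Hx Hy).
  - cbn in Hx; subst x; apply Hy; intros z [].
  - cbn in Hy; subst y; apply Hx; intros z [].
Qed.

Lemma derivation_valid (c : sequent AtProp) : derivation c -> valid c.
Proof.
  intros d; induction d as [c _ a | c1 c _ r d IH | c1 c2 c _ r d1 IH1 d2 IH2
                           | c1 c2 c _ r d1 IH1 d2 IH2].
  - exact (valid_axiom a).
  - exact (valid_unary r IH).
  - exact (valid_binary r IH1 IH2).
  - exact (valid_cut r IH1 IH2).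
Qed.

Lemma cut_elimination (c : sequent AtProp) : derivable c -> cut_free_derivable c.
Proof.
  intros [d]; apply (valid_provable (derivation_valid d)).
  destruct d; assumption.
Qed.

End CutElimination.

(** * The subformula property *)

Lemma subformula_trans (AtProp : Type) (t u v : ty) (A : formula AtProp t)
    (B : formula AtProp u) (C : formula AtProp v) :
  subformula A B -> subformula B C -> subformula A C.
Proof. intros HAB HBC; induction HBC; [exact HAB | constructor; assumption ..]. Qed.

Section Leaves.

Variables (AtProp : Type) (P : forall t, formula AtProp t -> Prop).

(** Defined by recursion, so that the leaves of a compound structure are
    found by computation rather than by inversion of the indexed [occurs_in]. *)
Fixpoint leaves (t : ty) (x : structure AtProp t) : Prop :=
  match x with
  | Fm A => P A
  | SI => True
  | Bullet U => leaves U
  | Circ _ X => leaves X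
  | Unit _ => True
  | Dot U V => leaves U /\ leaves V
  | Sup U V => leaves U /\ leaves V
  end.

Definition sequent_leaves (c : sequent AtProp) : Prop :=
  leaves (precedent c) /\ leaves (succedent c).

Lemma leaves_occurs (t u : ty) (A : formula AtProp t) (x : structure AtProp u) :
  occurs_in A x -> leaves x -> P A.
Proof. intros o; induction o; cbn; tauto. Qed.

Lemma occurs_leaves (u : ty) (x : structure AtProp u) :
  (forall t (A : formula AtProp t), occurs_in A x -> P A) -> leaves x.
Proof.
  induction x; cbn; intros H; auto.
  - apply H; constructor.
  - apply IHx; intros; apply H; constructor; assumption.
  - apply IHx; intros; apply H; constructor; assumption.
  - split; [apply IHx1 | apply IHx2]; intros; apply H;
      [apply Occ_Dot_l | apply Occ_Dot_r]; assumption.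
  - split; [apply IHx1 | apply IHx2]; intros; apply H;
      [apply Occ_Sup_l | apply Occ_Sup_r]; assumption.
Qed.

Hypothesis P_subformula : forall t u (A : formula AtProp t) (B : formula AtProp u),
  subformula A B -> P B -> P A.

Lemma leaves_unary (c1 c : sequent AtProp) :
  unary_rule c1 c -> sequent_leaves c -> sequent_leaves c1.
Proof.
  intros r; destruct r as [? ? r | ? ? r | | | | | | | | | | | | | | | | | | | |];
    try destruct r; unfold sequent_leaves; cbn; intuition;
    (eapply P_subformula; [| eassumption];
     solve [constructor; apply Sub_refl | apply Sub_Cap_r, Sub_refl
           | apply Sub_Cup_r, Sub_refl]).
Qed.

Lemma leaves_binary (c1 c2 c : sequent AtProp) :
  binary_rule c1 c2 c -> sequent_leaves c -> sequent_leaves c1 /\ sequent_leaves c2.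
Proof.
  intros r; destruct r; unfold sequent_leaves; cbn; intuition;
    (eapply P_subformula; [| eassumption];
     solve [constructor; apply Sub_refl | apply Sub_Cap_r, Sub_refl
           | apply Sub_Cup_r, Sub_refl]).
Qed.

Lemma leaves_derivation (c : sequent AtProp) (d : derivation c) :
  cut_free d -> sequent_leaves c ->
  forall t (A : formula AtProp t), occurs_in_derivation A d -> P A.
Proof.
  intros cf L t A o.
  assert (here : forall c', sequent_leaves c' -> occurs_in_sequent A c' -> P A).
  { intros c' [Lp Ls] [o' | o']; eapply leaves_occurs; eassumption. }
  induction d as [c adm a | c1 c adm r d IH | c1 c2 c adm r d1 IH1 d2 IH2
                 | c1 c2 c adm r d1 IH1 d2 IH2]; cbn in cf, o.
  - destruct o as [o | []]; exact (here c L o).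
  - destruct o as [o | o]; [exact (here c L o) |].
    exact (IH cf (leaves_unary r L) o).
  - destruct (leaves_binary r L) as [L1 L2], cf as [cf1 cf2].
    destruct o as [o | [o | o]]; [exact (here c L o) | auto | auto].
  - destruct cf.
Qed.

End Leaves.

Lemma subformula_property (AtProp : Type) (c : sequent AtProp) (d : derivation c) :
  cut_free d -> forall (t : ty) (A : formula AtProp t), occurs_in_derivation A d ->
  exists (u : ty) (B : formula AtProp u), occurs_in_sequent B c /\ subformula A B.
Proof.
  intros cf; apply (leaves_derivation (P := fun t A =>
    exists u (B : formula AtProp u), occurs_in_sequent B c /\ subformula A B));
    [| exact cf |].
  - intros t u A B HAB [v [C [o HBC]]].
    exists v, C; split; [exact o | exact (subformula_trans HAB HBC)].
  - split; apply occurs_leaves; intros t A o; exists t, A;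
      (split; [| apply Sub_refl]); [left | right]; exact o.
Qed.

Theorem mainTheorem4 (AtProp : Type) :
  (forall c : sequent AtProp, derivable c -> cut_free_derivable c) /\
  (forall (c : sequent AtProp) (d : derivation c), cut_free d ->
     forall (t : ty) (A : formula AtProp t), occurs_in_derivation A d ->
     exists (u : ty) (B : formula AtProp u),
       occurs_in_sequent B c /\ subformula A B).
Proof.
  split.
  - intros c; apply cut_elimination.
  - intros c d; apply subformula_property.
Qed.
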